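(* There is an absolute constant $K>0$ such that the following holds. Let $\Psi=(\psi_i)_{i=1}^n$ and $\Theta=(\theta_i)_{i=1}^n$ be orthonormal bases of $\mathbb{C}^n$, and put $\kappa=\kappa(\Psi,\Theta)$. Let $A\in\mathbb{C}^{m,n}$ be a random measurement matrix whose rows are given by i.i.d. copies of a random vector $X\in\mathbb{C}^n$ with the following properties: (i) (Isotropy) $\mathbb{E}(XX^* )=\operatorname{id}$; (ii) (Incoherence to $\Psi$) $\sup_{\psi\in\Psi}|\langle X,\psi\rangle|\le M$ almost surely; (iii) (Incoherence to $\Theta$) $\sup_{\theta\in\Theta}|\langle X,\theta\rangle|\le M$ almost surely. Suppose that $x_0=\Psi c^1+\Theta c^2$ with $c^1,c^2\in\mathbb{C}^n$, $\|c^1\|_1+\|c^2\|_1=1$, and let $i_0\in\operatorname{supp}c^1$. Suppose there exists $\gamma>0$ with $$\kappa\cdot\frac{4}{|c^1_{i_0}|}\le 1-\gamma.$$ Let $\delta\in(0,1)$. If $m=p\cdot r$ with positive integers $p,r$ satisfying $$r\ge\log\left(\frac{8}{\gamma}\right)\quad\text{and}\quad p\ge K\left(C_\gamma^2\frac{M^2}{\kappa^2}+\frac{C_\gamma(M^2+\kappa)}{\kappa}\right)\log\left(\frac{nr}{\delta}\right),$$ where $C_\gamma=\frac{3}{\gamma}\left(1-\frac{2\gamma}{3}\right)$, then with probability larger than $1-\delta$, any solution $(c^1_*,c^2_* )$ of $$\min_{c^1,c^2\in\mathbb{C}^n}\|c^1\|_1+\|c^2\|_1\ \text{ subject to }\ A(\Psi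 c^1+\Theta c^2)=b,\qquad b=Ax_0,$$ has the property $i_0\in\operatorname{supp}c^1_*$.
   Context: Orthonormal bases are identified with the unitary matrices having the basis vectors as columns, so $\Psi c=\sum_i c_i\psi_i$. The mutual coherence is $\kappa(\Psi,\Theta)=\max_{\psi\in\Psi,\theta\in\Theta}|\langle\psi,\theta\rangle|$. With $X^1,\dots,X^m$ the i.i.d. copies of $X$, the measurements are $(Av)_\ell=\langle v,X^\ell\rangle=(X^\ell)^*v$, $\ell=1,\dots,m$. The support of a vector $c$ is $\operatorname{supp}c=\{i:c_i\ne 0\}$. *)

(* Defs.v *)
From HB Require Import structures.
From mathcomp Require Import all_boot all_order all_algebra.
From mathcomp Require Import all_classical all_reals all_analysis.
From mathcomp Require Import complex.

Set Implicit Arguments.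
Unset Strict Implicit.
Unset Printing Implicit Defensive.

Import Order.TTheory GRing.Theory Num.Theory.
Local Open Scope classical_set_scope.
Local Open Scope ring_scope.
Local Open Scope complex_scope.
Local Open Scope sesquilinear_scope.

(* The modulus is taken in R (normc), because the norm of the numDomainType
   R[i] takes its values in R[i]. *)
Notation cmod := ComplexField.Normc.normc.

Definition inner (R : rcfType) (n : nat) (v w : 'cV[R[i]]_n) : R[i] :=
  (w ^t* *m v) ord0 ord0.

Definition norm1 (R : rcfType) (n : nat) (c : 'cV[R[i]]_n) : R :=
  \sum_(i < n) cmod (c i ord0).

Definition supp (R : rcfType) (n : nat) (c : 'cV[R[i]]_n) : {set 'I_n} :=
  finset (fun i => c i ord0 != 0).

(* sup of |<v, psi>| over the columns psi of Psi; the default value 0 of the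
   iterated maximum is harmless since moduli are nonnegative. *)
Definition max_corr (R : rcfType) (n : nat) (v : 'cV[R[i]]_n)
    (Psi : 'M[R[i]]_n) : R :=
  \big[Num.max/0]_(i < n) cmod (inner v (col i Psi)).

Definition coherence (R : rcfType) (n : nat) (Psi Theta : 'M[R[i]]_n) : R :=
  \big[Num.max/0]_(i < n) max_corr (col i Psi) Theta.

(* The Borel sigma-algebra of C^n = R^(2n) is the one generated by the real
   and imaginary parts of the coordinates. *)
Definition coordinate_cylinders (R : realType) (n : nat) :
    set (set 'cV[R[i]]_n) :=
  [set A | exists (i : 'I_n) (B : set R), measurable B /\
     (A = [set v : 'cV[R[i]]_n | B (complex.Re (v i ord0))] \/
      A = [set v : 'cV[R[i]]_n | B (complex.Im (v i ord0))])].

HB.instance Definition _ (R : realType) := isPointed.Build R[i] 0.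

Definition borel_cV (R : realType) (n : nat) :=
  g_sigma_algebraType (@coordinate_cylinders R n).

Section probability.
Context d (T : measurableType d) (R : realType) (P : probability T R).

(* Mutual independence: the product rule over every finite subfamily. *)
Definition mutually_independent d' (U : measurableType d') (I : finType)
    (X : I -> T -> U) : Prop :=
  forall (J : {set I}) (B : I -> set U), (forall l, measurable (B l)) ->
    P [set w | forall l, l \in J -> B l (X l w)] =
    (\prod_(l in J) P (X l @^-1` B l))%E.

Definition iid_copies d0 (T0 : measurableType d0) (P0 : probability T0 R)
    d' (U : measurableType d') (X0 : T0 -> U) (I : finType)
    (X : I -> T -> U) : Prop :=
  [/\ forall l, measurable_fun [set: T] (X l),
      forall l (B : set U), measurable B ->
        pushforward P (X l) B = pushforward P0 X0 B
    & mutually_independent X].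

Definition cexpectation (f : T -> R[i]) : R[i] :=
  fine ('E_P[(fun w => complex.Re (f w))])%E +i*
  fine ('E_P[(fun w => complex.Im (f w))])%E.

Definition mx_expectation (m n : nat) (F : T -> 'M[R[i]]_(m, n)) :
    'M[R[i]]_(m, n) :=
  \matrix_(i, j) cexpectation (fun w => F w i j).

(* A holds with probability larger than p; phrased through a measurable
   subevent so that P is never evaluated at a set not known to be measurable. *)
Definition with_probability_gt (p : R) (A : set T) : Prop :=
  exists F : set T, [/\ measurable F, F `<=` A & (p%:E < P F)%E].

End probability.

(* The l-th row is (X^l)^*, so that (A v)_l = <v, X^l>. *)
Definition measurement_matrix (R : rcfType) (m n : nat)
    (X : 'I_m -> 'cV[R[i]]_n) : 'M[R[i]]_(m, n) :=
  \matrix_(l, j) (X l ^t*) ord0 j.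

Definition feasible (R : rcfType) (m n : nat) (A : 'M[R[i]]_(m, n))
    (Psi Theta : 'M[R[i]]_n) (b : 'cV[R[i]]_m) (c1 c2 : 'cV[R[i]]_n) : Prop :=
  A *m (Psi *m c1 + Theta *m c2) = b.

Definition is_solution (R : rcfType) (m n : nat) (A : 'M[R[i]]_(m, n))
    (Psi Theta : 'M[R[i]]_n) (b : 'cV[R[i]]_m) (c1 c2 : 'cV[R[i]]_n) : Prop :=
  feasible A Psi Theta b c1 c2 /\
  forall d1 d2, feasible A Psi Theta b d1 d2 ->
    norm1 c1 + norm1 c2 <= norm1 d1 + norm1 d2.

(* Main.v *)
Require Import Defs.
From mathcomp Require Import all_boot all_order all_algebra.
From mathcomp Require Import all_classical all_reals all_analysis.
From mathcomp Require Import complex.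
From mathcomp Require Import measurable_realfun.
From mathcomp Require Import ring lra.
Import Order.TTheory GRing.Theory Num.Theory.
Import numFieldNormedType.Exports.
Local Open Scope classical_set_scope.
Local Open Scope ring_scope.
Local Open Scope complex_scope.
Local Open Scope sesquilinear_scope.

(* The factor 4 in the coherence hypothesis leaves enough room that no golfing
   scheme is needed: the one-step dual certificate v = (1/m) A^* A psi_{i0}
   suffices.  Isotropy gives E <v, u> = <psi_{i0}, u>, and each summand of <v, u>
   is bounded by M^2 with second moment at most M^2, so Bernstein's inequality
   and a union bound give |<v, u> - <psi_{i0}, u>| <= kappa / 2 for all u in Psi
   and Theta, outside an event of probability less than delta.  On this event
   |<v, psi_{i0}> - 1| <= kappa / 2, while the modulus of <v, u> is at most
   3 kappa / 2 for every other u.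
   Since <., v> takes the same value on x_0 and on every feasible vector, a
   solution of norm at most 1 with vanishing i0-th coefficient would force
   (1 - kappa/2) |c_{i0}| <= (3 kappa / 2) (2 - |c_{i0}|), which contradicts
   4 kappa < |c_{i0}| <= 1.  The hypotheses imply 0 < kappa, gamma < 1, Cgamma >= 1
   and r >= 2, so p samples already suffice. *)

(** * Independence: from events to nonnegative functions *)

Section independence.
Context {d} {T : measurableType d} {R : realType} (P : probability T R).
Context {d'} {U : measurableType d'}.
Local Open Scope ereal_scope.
Import HBNNSimple.

Lemma integral_indic_comp (Z : T -> U) (B : set U) :
  measurable_fun [set: T] Z -> measurable B ->
  \int[P]_w (\1_B (Z w))%:E = P (Z @^-1` B).
Proof.
move=> mZ mB; have mZB : measurable (Z @^-1` B).
  by rewrite -[X in measurable X]setTI; exact: mZ.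
by rewrite -[in RHS](setIT (Z @^-1` B)) -integral_indic.
Qed.

(** The hypothesis says that weighting by [G] multiplies the probability of every event of [Z] by
    [c]. Linearity carries this to simple functions, and monotone convergence to nonnegative
    measurable ones. *)
Lemma integral_density_comp (G : T -> R) (Z : T -> U) (c : R) :
  measurable_fun [set: T] G -> (forall w, 0 <= G w)%R ->
  measurable_fun [set: T] Z ->
  (forall B, measurable B ->
    \int[P]_w (G w * \1_B (Z w))%:E = c%:E * P (Z @^-1` B)) ->
  forall f : U -> R, measurable_fun [set: U] f -> (forall x, 0 <= f x)%R ->
  \int[P]_w (G w * f (Z w))%:E = c%:E * \int[P]_w (f (Z w))%:E.
Proof.
move=> mG G0 mZ hG f mf f0.
have mef : measurable_fun setT (EFin \o f) by exact/measurable_EFinP.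
pose h := nnsfun_approx measurableT mef.
have cvgh x : (h n x)%:E @[n --> \oo] --> (f x)%:E.
  by apply: (@cvg_nnsfun_approx _ _ _ _ measurableT _ mef) => // y _; rewrite lee_fin.
have ndh x a b : (a <= b)%N -> (h a x <= h b x)%R.
  by move=> ab; exact/lefP/nd_nnsfun_approx.
have mhZ n : measurable_fun setT (fun w => h n (Z w)).
  by apply: measurableT_comp.
have simple n : \int[P]_w (G w * h n (Z w))%:E =
    c%:E * \int[P]_w (h n (Z w))%:E.
  have mZk k : measurable (h n @^-1` [set k]) by exact: measurable_sfunP.
  have mIk k : measurable_fun setT (fun w => \1_(h n @^-1` [set k]) (Z w) : R).
    by apply: measurableT_comp => //; exact: measurable_indic.
  have nn k w : (0 <= k * \1_(h n @^-1` [set k]) (Z w) :> R)%R.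
    by have := nnfun_muleindic_ge0 (h n) k (Z w); rewrite -EFinM lee_fin.
  have k0 k : (k < 0)%R -> h n @^-1` [set k] = set0 by exact: preimage_nnfun0.
  under eq_integral => w _.
    rewrite fimfunE mulr_fsumr -fsumEFin//.
    over.
  rewrite ge0_integral_fsum//; last 2 first.
  - by move=> k; apply/measurable_EFinP; apply: measurable_funM => //;
      apply: measurable_funM.
  - by move=> k w _; rewrite lee_fin mulr_ge0.
  under [in RHS]eq_integral => w _.
    rewrite fimfunE -fsumEFin//.
    over.
  rewrite [in RHS]ge0_integral_fsum//; last 2 first.
  - by move=> k; apply/measurable_EFinP; apply: measurable_funM.
  - by move=> k w _; rewrite lee_fin.
  rewrite ge0_mule_fsumr; last first.
    by move=> k; apply: integral_ge0 => w _; rewrite lee_fin.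
  apply: eq_fsbigr => k _.
  (* [h n] is nonnegative, so a negative [k] has empty preimage and contributes zero; a nonnegative
     [k] can be pulled out of both integrals. *)
  have [kneg|kpos] := ltP k 0%R.
    under eq_integral do rewrite k0// indic0 mulr0 mulr0.
    under [in RHS]eq_integral do rewrite k0// indic0 mulr0.
    by rewrite integral0 mule0.
  under eq_integral do rewrite mulrCA EFinM.
  rewrite ge0_integralZl//; last 2 first.
  - by apply/measurable_EFinP; apply: measurable_funM.
  - by move=> w _; rewrite lee_fin mulr_ge0.
  rewrite hG//.
  under [in RHS]eq_integral do rewrite EFinM.
  rewrite ge0_integralZl//; last exact/measurable_EFinP.
  by rewrite integral_indic_comp// muleCA.
transitivity (limn (fun n => \int[P]_w (G w * h n (Z w))%:E)).
  rewrite -monotone_convergence//.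
  - apply: eq_integral => w _; apply/esym/cvg_lim => //.
    by rewrite EFinM; under eq_fun do rewrite EFinM; apply: cvgeZl.
  - by move=> n; apply/measurable_EFinP; exact: measurable_funM.
  - by move=> n w _; rewrite lee_fin mulr_ge0.
  - by move=> w _ a b ab; rewrite lee_fin ler_wpM2l// ndh.
have -> : \int[P]_w (f (Z w))%:E = limn (fun n => \int[P]_w (h n (Z w))%:E).
  rewrite -monotone_convergence//.
  - by apply: eq_integral => w _; apply/esym/cvg_lim.
  - by move=> n; apply/measurable_EFinP.
  - by move=> n w _; rewrite lee_fin.
  - by move=> w _ a b ab; rewrite lee_fin ndh.
rewrite -limeMl//; first by congr (limn _); apply/funext => n.
apply/ereal_nondecreasing_is_cvgn => a b ab; apply: ge0_le_integral => //.
- by move=> w _; rewrite lee_fin.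
- exact/measurable_EFinP.
- exact/measurable_EFinP.
- by move=> w _; rewrite lee_fin ndh.
Qed.

Lemma integral_prod_indep {I : finType} (X : I -> T -> U) :
  (forall l, measurable_fun [set: T] (X l)) -> mutually_independent P X ->
  forall (f : I -> U -> R) (e : I -> R),
  (forall l, measurable_fun [set: U] (f l)) -> (forall l x, 0 <= f l x)%R ->
  (forall l, \int[P]_w (f l (X l w))%:E = (e l)%:E) ->
  \int[P]_w (\prod_l f l (X l w))%:E = (\prod_l e l)%:E.
Proof.
move=> mX indep f e mf f0 fe.
(* Replace indicators by arbitrary functions one index at a time. *)
suff main : forall (s : seq I) (g : I -> U -> R) (a : I -> R),
    (forall l, measurable_fun [set: U] (g l)) -> (forall l x, 0 <= g l x)%R ->
    (forall l, \int[P]_w (g l (X l w))%:E = (a l)%:E) ->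
    (forall l, l \notin s -> exists2 B, measurable B & g l = \1_B) ->
    \int[P]_w (\prod_l g l (X l w))%:E = (\prod_l a l)%:E.
  by apply: (main (enum I)) => // l; rewrite mem_enum.
elim=> [g a mg g0 ga hg|l0 s ih g a mg g0 ga hg].
  (* When all factors are indicators, their product is the indicator of the event that every [X l]
     lies in [B l]; independence is used for the full index set. *)
  have /choice[B hB] : forall l, exists B, measurable B /\ g l = \1_B.
    by move=> l; have [//|B mB ->] := hg l; exists B.
  have gB l : g l = \1_(B l) by case: (hB l).
  have mB l : measurable (B l) by case: (hB l).
  have mXB l : measurable (X l @^-1` B l).
    by rewrite -[X in measurable X]setTI; exact: mX.
  have aB l : P (X l @^-1` B l) = (a l)%:E.
    by rewrite -ga gB integral_indic_comp.
  have <- : P [set w | forall l, l \in [set: I]%SET -> B l (X l w)] =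
      (\prod_l a l)%:E.
    rewrite indep// -prodEFin; apply: eq_big => [l|l _]; last exact: aB.
    by rewrite inE.
  rewrite -[in RHS](setIT [set w | _]) -integral_indic//; last first.
    rewrite (_ : [set w | _] = \bigcap_(l in [set: I]) (X l @^-1` B l)); last first.
      apply/seteqP; split=> w /= h' l; last by move=> _; apply: h'.
      by move=> _; apply: h'; rewrite inE.
    by apply: fin_bigcap_measurable.
  apply: eq_integral => w _; congr (_ %:E).
  under eq_bigr do rewrite gB indicE.
  rewrite indicE; case: (boolP (w \in _)) => [|/negP] hw.
    rewrite big1// => l _; move: hw; rewrite inE => /(_ l).
    by rewrite !inE/= => /(_ isT) ?; rewrite mem_set.
  have [l hl] : exists l, ~ B l (X l w).
    by apply/existsNP => h'; apply: hw; rewrite inE => l _.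
  by rewrite (bigD1 l)//= memNset// mul0r.
have prodD1 (b : I -> R) : (\prod_l b l = (\prod_(l | l != l0) b l) * b l0)%R.
  by rewrite (bigD1 l0)//= mulrC.
under eq_integral do rewrite prodD1.
rewrite prodD1 EFinM -ga.
(* The factors at indices other than [l0] form the weight, and [c] is the product of their means.
   The condition on sets is then the induction hypothesis with [g l0] replaced by an indicator. *)
apply: (integral_density_comp (fun w => \prod_(l | l != l0) g l (X l w))%R
  (X l0)) => //.
- under eq_fun do rewrite -big_filter.
  by apply: measurable_prod => l _; apply: measurableT_comp.
- by move=> w; apply: prodr_ge0.
move=> B mB.
pose g' l := if l == l0 then \1_B else g l.
have mXB : measurable (X l0 @^-1` B).
  by rewrite -[X in measurable X]setTI; exact: mX.
pose a' l := if l == l0 then fine (P (X l0 @^-1` B)) else a l.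
have -> : (\prod_(l | l != l0) a l)%:E * P (X l0 @^-1` B) = (\prod_l a' l)%:E.
  rewrite prodD1 EFinM /a' eqxx fineK ?fin_num_measure//.
  by congr (_%:E * _); apply: eq_bigr => l /negbTE ->.
rewrite -(ih g' a').
- apply: eq_integral => w _; congr (_%:E); rewrite prodD1 /g' eqxx.
  by congr (_ * _)%R; apply: eq_bigr => l /negbTE ->.
- by move=> l; rewrite /g'; case: eqP => // _; exact: measurable_indic.
- by move=> l x; rewrite /g'; case: eqP.
- move=> l; rewrite /g' /a'; case: eqP => // ->.
  by rewrite fineK ?fin_num_measure// integral_indic_comp.
- move=> l ls; rewrite /g'; case: eqP => [_|/eqP ll0]; first by exists B.
  by apply: hg; rewrite inE negb_or ll0.
Qed.

End independence.

(** * Exponential moments and Bernstein's inequality *)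

Section bernstein.
Context {R : realType}.

(** From [1 - x <= expR (- x)] follows [expR x <= (1 - x)^-1], and
    [(1 - x) * (1 + x + 2 * x ^+ 2) - 1] equals [x ^+ 2 * (1 - 2 * x)], which is nonnegative in this
    range. *)
Lemma expR_le_quad (x : R) : x <= 1 / 2 -> expR x <= 1 + x + 2 * x ^+ 2.
Proof.
move=> x12; have := expR_ge1Dx (- x); rewrite expRN => h.
have x1 : 0 < 1 - x by lra.
have hx : expR x <= (1 - x)^-1.
  by rewrite -[expR x]invrK lef_pV2// posrE invr_gt0 expR_gt0.
apply: (le_trans hx); rewrite -div1r ler_pdivrMr//.
have : 0 <= x ^+ 2 * (1 - 2 * x) by apply: mulr_ge0; [exact: sqr_ge0|lra].
nra.
Qed.

Section moment.
Context {d} {T : measurableType d} (P : probability T R).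
Local Open Scope ereal_scope.

Lemma integral_cst_probability (r : R) : \int[P]_w r%:E = r%:E.
Proof.
apply: etrans (integral_cst P measurableT r%:E) _.
exact: etrans (congr1 (mule r%:E) (probability_setT P)) (mule1 _).
Qed.

(** The condition on [lam * b] keeps the exponent almost everywhere in the range of the quadratic
    bound. Integrating that bound leaves [1 + y] with [y = lam * mu + 2 * lam ^+ 2 * v], which is at
    most [expR y]. *)
Lemma mgf_le (g : T -> R) (mu v b lam : R) :
  P.-integrable [set: T] (EFin \o g) ->
  \int[P]_w (g w)%:E = mu%:E -> \int[P]_w (g w ^+ 2)%:E <= v%:E ->
  {ae P, forall w, (`|g w| <= b)%R} -> (0 <= lam)%R -> (lam * b <= 1 / 2)%R ->
  \int[P]_w (expR (lam * g w))%:E <= (expR (lam * mu + 2 * lam ^+ 2 * v))%:E.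
Proof.
move=> ig gmu gv gb lam0 lamb.
have mg : measurable_fun setT g by apply/measurable_EFinP/(measurable_int P).
have mg2 : measurable_fun setT (fun w => g w ^+ 2)%R by exact: measurable_funX.
have ig2 : P.-integrable setT (EFin \o (fun w => g w ^+ 2)%R).
  apply/integrableP; split; first exact/measurable_EFinP.
  under eq_integral => w _ do rewrite /= ger0_norm ?sqr_ge0//.
  by apply: (le_lt_trans gv); rewrite ltry.
have quad_ge0 x : (0 <= 1 + x + 2 * x ^+ 2 :> R)%R by nra.
apply: (@le_trans _ _
    (\int[P]_w (1 + lam * g w + 2 * (lam * g w) ^+ 2)%:E)).
  apply: ae_ge0_le_integral => //.
  - apply/measurable_EFinP; apply: measurableT_comp => //.
    exact: measurable_funM.
  - by move=> w _; rewrite lee_fin quad_ge0.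
  - apply/measurable_EFinP; apply: measurable_funD.
      by apply: measurable_funD => //; exact: measurable_funM.
    by apply: measurable_funM => //; apply: measurable_funX; exact: measurable_funM.
  - apply: filterS gb => w gwb _; rewrite lee_fin; apply: expR_le_quad.
    apply: le_trans lamb; apply: ler_wpM2l => //.
    exact: le_trans (ler_norm _) gwb.
have i1 : P.-integrable setT (EFin \o (fun w => 1 + lam * g w)%R).
  apply: (eq_integrable measurableT (EFin \o cst 1%R \+ (fun w => lam%:E * (g w)%:E))) => //.
  apply: integrableD => //; first exact: finite_measure_integrable_cst.
  exact: integrableZl.
have i2 : P.-integrable setT (EFin \o (fun w => 2 * (lam * g w) ^+ 2)%R).
  apply: (eq_integrable measurableT (fun w => (2 * lam ^+ 2)%:E * (g w ^+ 2)%:E)) => //.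
    by move=> w _ /=; rewrite -EFinM -mulrA -exprMn.
  exact: integrableZl.
rewrite (_ : (fun w => _) = (EFin \o (fun w => 1 + lam * g w)%R \+
   (EFin \o (fun w => 2 * (lam * g w) ^+ 2)%R))) //.
rewrite integralD_EFin//.
have -> : \int[P]_w (EFin \o (fun w => 1 + lam * g w)%R) w = (1 + lam * mu)%:E.
  rewrite (_ : EFin \o _ = (EFin \o cst 1%R \+ EFin \o (fun w => lam * g w)%R)) //.
  rewrite integralD_EFin//; last 2 first.
  - exact: finite_measure_integrable_cst.
  - exact: (integrableZl measurableT lam ig).
  have -> := integral_cst_probability 1.
  rewrite EFinD; congr (_ + _).
  under eq_integral do rewrite /= EFinM.
  by rewrite integralZl// gmu.
have -> : \int[P]_w (EFin \o (fun w => 2 * (lam * g w) ^+ 2)%R) w =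
    (2 * lam ^+ 2)%:E * \int[P]_w (g w ^+ 2)%:E.
  rewrite -integralZl//; apply: eq_integral => w _ /=.
  by rewrite exprMn mulrA EFinM.
apply: (@le_trans _ _ ((1 + lam * mu)%:E + (2 * lam ^+ 2)%:E * v%:E)).
  by apply: leeD => //; apply: lee_wpmul2l => //; rewrite lee_fin; nra.
rewrite -EFinM -EFinD lee_fin -addrA.
exact: expR_ge1Dx.
Qed.

End moment.

Local Open Scope ereal_scope.

Lemma iid_integral {d} {T : measurableType d} (P : probability T R)
    {d0} {T0 : measurableType d0} (P0 : probability T0 R)
    {d'} {U : measurableType d'} (X0 : T0 -> U) {I : finType} (X : I -> T -> U) :
  measurable_fun [set: T0] X0 -> iid_copies P P0 X0 X ->
  forall (l : I) (f : U -> \bar R), measurable_fun [set: U] f ->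
  (forall x, 0 <= f x) -> \int[P]_w f (X l w) = \int[P0]_w f (X0 w).
Proof.
move=> mX0 [mX eqX _] l f mf f0.
pose X0' : {mfun T0 >-> U} := mfun_Sub (mem_set mX0).
pose X' : {mfun T >-> U} := mfun_Sub (mem_set (mX l)).
rewrite -(ge0_integral_distribution X' mf f0).
rewrite -(ge0_integral_distribution X0' mf f0).
by apply: eq_measure_integral => B mB _; exact: eqX.
Qed.

(** Chernoff's bound, where independence turns the exponential moment of the sum into a power of
    that of one summand. The parameter [lam] stays free until the second moment bound [v] is
    known. *)
Lemma bernstein {d} {T : measurableType d} (P : probability T R)
    {d0} {T0 : measurableType d0} (P0 : probability T0 R)
    {d'} {U : measurableType d'} (X0 : T0 -> U) {I : finType} (X : I -> T -> U)
    (g : U -> R) (mu v b lam t : R) :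
  measurable_fun [set: T0] X0 -> iid_copies P P0 X0 X ->
  measurable_fun [set: U] g ->
  P0.-integrable [set: T0] (EFin \o (g \o X0)) ->
  \int[P0]_w (g (X0 w))%:E = mu%:E ->
  \int[P0]_w (g (X0 w) ^+ 2)%:E <= v%:E ->
  {ae P0, forall w, (`|g (X0 w)| <= b)%R} ->
  (0 < lam)%R -> (lam * b <= 1 / 2)%R ->
  P [set w | (#|I|%:R * (mu + t) <= \sum_l g (X l w))%R] <=
    (expR (- (#|I|%:R * (lam * t - 2 * lam ^+ 2 * v))))%:E.
Proof.
move=> mX0 iidX mg ig gmu gv gb lam0 lamb.
have [mX _ indX] := iidX.
have mS : measurable_fun setT (fun w => \sum_l g (X l w))%R.
  by apply: measurable_sum => l; apply: measurableT_comp.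
pose S : {mfun T >-> R} := mfun_Sub (mem_set mS).
have mE : measurable_fun setT (fun x => expR (lam * g x)).
  by apply: measurableT_comp => //; exact: measurable_funM.
have hE : \int[P0]_w (expR (lam * g (X0 w)))%:E <=
    (expR (lam * mu + 2 * lam ^+ 2 * v))%:E.
  by apply: (mgf_le P0) ig gmu gv gb (ltW lam0) lamb.
have E0 : 0 <= \int[P0]_w (expR (lam * g (X0 w)))%:E.
  by apply: integral_ge0 => w _; rewrite lee_fin expR_ge0.
(* The moment bound makes the integral finite, so its real value [e] can enter the product rule. *)
pose e := fine (\int[P0]_w (expR (lam * g (X0 w)))%:E).
have eE : \int[P0]_w (expR (lam * g (X0 w)))%:E = e%:E.
  by rewrite /e fineK// ge0_fin_numE// (le_lt_trans hE)// ltry.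
apply: (le_trans (@chernoff _ _ _ P S lam (#|I|%:R * (mu + t))%R lam0)).
 rewrite /mmt_gen_fun unlock.
have -> : \int[P]_w ((expR \o (lam \o* S)) w)%:E = (e ^+ #|I|)%:E.
  under eq_integral => w _.
    rewrite /= mulrC mulr_sumr expR_sum; over.
  rewrite (integral_prod_indep P _ mX indX (fun _ x => expR (lam * g x))%R (fun=> e)) //.
  - by rewrite prodr_const.
  - move=> l; rewrite -eE.
    apply: (iid_integral _ _ _ _ mX0 iidX l (fun x => (expR (lam * g x))%:E)).
      exact/measurable_EFinP.
    by move=> x; rewrite lee_fin expR_ge0.
rewrite -EFinM lee_fin.
apply: (@le_trans _ _ (expR (lam * mu + 2 * lam ^+ 2 * v) ^+ #|I|
   * expR (- (lam * (#|I|%:R * (mu + t)))))%R).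
  apply: ler_wpM2r; first exact: expR_ge0.
  by apply: lerXn2r; rewrite ?nnegrE ?expR_ge0// -lee_fin -eE.
rewrite -expRM_natl -expRD ler_expR; lra.
Qed.

End bernstein.

(** * Modulus, real part and imaginary part *)

Section complex_modulus.
Context {R : rcfType}.
Implicit Types z : R[i].

Lemma cmod_sqr z : cmod z ^+ 2 = complex.Re z ^+ 2 + complex.Im z ^+ 2.
Proof. by case: z => a b /=; rewrite sqr_sqrtr// addr_ge0// sqr_ge0. Qed.

Lemma cmod_ge0 z : 0 <= cmod z.
Proof. by case: z => a b; exact: sqrtr_ge0. Qed.

Lemma cmod_conj z : cmod z^*%C = cmod z.
Proof. by case: z => a b /=; rewrite sqrrN. Qed.

Lemma cmod_gt0 z : z != 0 -> 0 < cmod z.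
Proof.
move=> z0; rewrite lt_neqAle cmod_ge0 andbT eq_sym.
by apply: contraNneq z0 => /ComplexField.Normc.eq0_normc ->.
Qed.

Lemma normr_Re_le_cmod z : `|complex.Re z| <= cmod z.
Proof.
rewrite -(ler_pXn2r (n := 2))// ?nnegrE ?cmod_ge0// cmod_sqr real_normK ?num_real//.
by rewrite lerDl sqr_ge0.
Qed.

Lemma cmod_le_ReIm z : cmod z <= `|complex.Re z| + `|complex.Im z|.
Proof.
rewrite -(ler_pXn2r (n := 2))// ?nnegrE ?cmod_ge0 ?addr_ge0// cmod_sqr.
rewrite sqrrD !real_normK ?num_real// lerD2r lerDl.
by rewrite mulrn_wge0// mulr_ge0.
Qed.

Lemma cmod_sum (I : Type) (s : seq I) (Q : pred I) (F : I -> R[i]) :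
  cmod (\sum_(i <- s | Q i) F i) <= \sum_(i <- s | Q i) cmod (F i).
Proof.
elim/big_rec2: _ => [|i y z _ h]; first by rewrite ComplexField.Normc.normc0.
by apply: (le_trans (le_normcD _ _)); rewrite lerD2l.
Qed.

Lemma cReM (a b : R[i]) : complex.Re (a * b) =
  complex.Re a * complex.Re b - complex.Im a * complex.Im b.
Proof. by case: a b => [a1 a2] [b1 b2]. Qed.

Lemma cImM (a b : R[i]) : complex.Im (a * b) =
  complex.Re a * complex.Im b + complex.Im a * complex.Re b.
Proof. by case: a b => [a1 a2] [b1 b2]. Qed.

Lemma cReD (a b : R[i]) : complex.Re (a + b) = complex.Re a + complex.Re b.
Proof. by case: a b => [a1 a2] [b1 b2]. Qed.

Lemma cImD (a b : R[i]) : complex.Im (a + b) = complex.Im a + complex.Im b.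
Proof. by case: a b => [a1 a2] [b1 b2]. Qed.

Lemma cReB (a b : R[i]) : complex.Re (a - b) = complex.Re a - complex.Re b.
Proof. by case: a b => [a1 a2] [b1 b2]. Qed.

Lemma cRe_sum (I : Type) (s : seq I) (F : I -> R[i]) :
  complex.Re (\sum_(i <- s) F i) = \sum_(i <- s) complex.Re (F i).
Proof. by apply: (big_morph (@complex.Re R) cReD). Qed.

Lemma cRe_natmul (k : nat) (z : R[i]) :
  complex.Re (k%:R * z) = k%:R * complex.Re z.
Proof.
rewrite !mulr_natl; elim: k => [|k ih]; first by rewrite !mulr0n.
by rewrite !mulrS cReD ih.
Qed.

End complex_modulus.

(** * The Hermitian inner product, linear in its first argument and conjugate-linear in its
    second *)

Section inner_product.
Context {R : rcfType} {n : nat}.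
Implicit Types u v x : 'cV[R[i]]_n.

Lemma innerE v u : inner v u = \sum_i (u i ord0)^*%C * v i ord0.
Proof. by rewrite /inner mxE; apply: eq_bigr => i _; rewrite !mxE. Qed.

Lemma inner_conj v u : (inner v u)^*%C = inner u v.
Proof.
rewrite !innerE rmorph_sum; apply: eq_bigr => i _ /=.
by rewrite rmorphM/= conjcK mulrC.
Qed.

Lemma inner_scaler a v u : inner v (a *: u) = a^*%C * inner v u.
Proof.
rewrite !innerE mulr_sumr; apply: eq_bigr => i _.
by rewrite mxE rmorphM mulrA.
Qed.

Lemma inner_mulmxl (Phi : 'M[R[i]]_n) (c : 'cV[R[i]]_n) u :
  inner (Phi *m c) u = \sum_j c j ord0 * inner (col j Phi) u.
Proof.
rewrite /inner mulmxA mxE; apply: eq_bigr => j _; rewrite mulrC; congr (_ * _).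
by rewrite !mxE; apply: eq_bigr => k _; rewrite !mxE.
Qed.

Lemma innerDl v w u : inner (v + w) u = inner v u + inner w u.
Proof. by rewrite /inner mulmxDr mxE. Qed.

Lemma inner_unitary (Phi : 'M[R[i]]_n) (i j : 'I_n) :
  Phi \is unitarymx -> inner (col i Phi) (col j Phi) = (j == i)%:R.
Proof.
move=> /unitarymxP/mulmx1C h.
have := congr1 (fun A : 'M[R[i]]_n => A j i) h; rewrite [in RHS]mxE => <-.
by rewrite innerE [RHS]mxE; apply: eq_bigr => k _; rewrite !mxE.
Qed.

End inner_product.

(** * Complex random variables, treated through their real and imaginary parts *)

Section complex_random_variables.
Context {d} {T : measurableType d} {R : realType}.
Implicit Types f g : T -> R[i].

Definition cmeasurable f :=
  measurable_fun [set: T] (fun w => complex.Re (f w)) /\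
  measurable_fun [set: T] (fun w => complex.Im (f w)).

Lemma cmeasurable_cst a : cmeasurable (cst a).
Proof. by split; exact: measurable_cst. Qed.

Lemma cmeasurable_conj f : cmeasurable f -> cmeasurable (fun w => (f w)^*%C).
Proof.
move=> [fR fI]; split.
  by rewrite (_ : (fun _ => _) = (fun w => complex.Re (f w)))//;
    apply/funext => w; case: (f w).
rewrite (_ : (fun _ => _) = (fun w => - complex.Im (f w))).
  exact: measurableT_comp.
by apply/funext => w; case: (f w).
Qed.

Lemma cmeasurableD f g :
  cmeasurable f -> cmeasurable g -> cmeasurable (fun w => f w + g w).
Proof.
move=> [fR fI] [gR gI]; split.
  by under eq_fun do rewrite cReD; exact: measurable_funD.
by under eq_fun do rewrite cImD; exact: measurable_funD.
Qed.

Lemma cmeasurableM f g :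
  cmeasurable f -> cmeasurable g -> cmeasurable (fun w => f w * g w).
Proof.
move=> [fR fI] [gR gI]; split.
  by under eq_fun do rewrite cReM; apply: measurable_funB; exact: measurable_funM.
by under eq_fun do rewrite cImM; apply: measurable_funD; exact: measurable_funM.
Qed.

Lemma cmeasurable_sum (I : Type) (s : seq I) (F : I -> T -> R[i]) :
  (forall i, cmeasurable (F i)) -> cmeasurable (fun w => \sum_(i <- s) F i w).
Proof.
move=> mF; elim: s => [|i s ih].
  by under eq_fun do rewrite big_nil; exact: cmeasurable_cst.
by under eq_fun do rewrite big_cons; exact: cmeasurableD.
Qed.

Context (P : probability T R).

Definition cintegrable f :=
  P.-integrable [set: T] (EFin \o (fun w => complex.Re (f w))) /\
  P.-integrable [set: T] (EFin \o (fun w => complex.Im (f w))).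

Lemma cexpectationE f : cexpectation P f =
  \int[P]_w (complex.Re (f w)) +i* \int[P]_w (complex.Im (f w)).
Proof. by rewrite /cexpectation unlock. Qed.

Lemma integrable_lin (a b : R) (h k : T -> R) :
  P.-integrable [set: T] (EFin \o h) -> P.-integrable [set: T] (EFin \o k) ->
  P.-integrable [set: T] (EFin \o (fun w => a * h w + b * k w)) /\
  \int[P]_w (a * h w + b * k w) = a * \int[P]_w h w + b * \int[P]_w k w.
Proof.
move=> ih ik.
have iah : P.-integrable [set: T] (EFin \o (fun w => a * h w)).
  exact: (integrableZl measurableT a ih).
have ibk : P.-integrable [set: T] (EFin \o (fun w => b * k w)).
  exact: (integrableZl measurableT b ik).
split; first exact: (integrableD measurableT iah ibk).
by rewrite RintegralD// !RintegralZl.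
Qed.

Lemma cexpectation_scale_add (a : R[i]) f g : cintegrable f -> cintegrable g ->
  cintegrable (fun w => a * f w + g w) /\
  cexpectation P (fun w => a * f w + g w) =
  a * cexpectation P f + cexpectation P g.
Proof.
move=> [fR fI] [gR gI].
have [i1 e1] := integrable_lin (complex.Re a) (- complex.Im a) _ _ fR fI.
have [i2 e2] := integrable_lin (complex.Re a) (complex.Im a) _ _ fI fR.
have [i3 e3] := integrable_lin 1 1 _ _ i1 gR.
have [i4 e4] := integrable_lin 1 1 _ _ i2 gI.
have eR : (fun w => complex.Re (a * f w + g w)) = (fun w =>
    1 * (complex.Re a * complex.Re (f w) + - complex.Im a * complex.Im (f w)) +
    1 * complex.Re (g w)).
  by apply/funext => w; rewrite cReD cReM !mul1r mulNr.
have eI : (fun w => complex.Im (a * f w + g w)) = (fun w =>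
    1 * (complex.Re a * complex.Im (f w) + complex.Im a * complex.Re (f w)) +
    1 * complex.Im (g w)).
  by apply/funext => w; rewrite cImD cImM !mul1r.
split; first by split; rewrite ?eR ?eI.
rewrite !cexpectationE eR eI e3 e4 e1 e2 !mul1r.
by apply/eqP; rewrite eq_complex !cReD !cImD !cReM !cImM/= mulNr !eqxx.
Qed.

Lemma cexpectation_lincomb (I : Type) (s : seq I) (a : I -> R[i])
    (F : I -> T -> R[i]) : (forall i, cintegrable (F i)) ->
  cintegrable (fun w => \sum_(i <- s) a i * F i w) /\
  cexpectation P (fun w => \sum_(i <- s) a i * F i w) =
  \sum_(i <- s) a i * cexpectation P (F i).
Proof.
move=> iF; elim: s => [|i s [ih1 ih2]].
  under eq_fun do rewrite big_nil.
  rewrite big_nil; split.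
    by split; exact: finite_measure_integrable_cst.
  by rewrite cexpectationE/= !Rintegral_cst// !mul0r.
have [i1 e1] := cexpectation_scale_add (a i) _ _ (iF i) ih1.
by under eq_fun do rewrite big_cons; rewrite big_cons e1 ih2.
Qed.

End complex_random_variables.

(** * Isotropic vectors: second moments and tail bounds *)

Section isotropic_vector.
Context {R : realType} {n : nat}.

Lemma cmeasurable_coord (i : 'I_n) :
  cmeasurable (fun x : borel_cV R n => (x : 'cV[R[i]]_n) i ord0).
Proof.
by split=> _ B mB; rewrite setTI; apply: sub_sigma_algebra;
  exists i, B; split=> //; [left|right].
Qed.

Lemma cmeasurable_inner (u v : 'cV[R[i]]_n) :
  cmeasurable (fun x : borel_cV R n => inner x u * inner v x).
Proof.
have mu w : cmeasurable (fun x : borel_cV R n => inner x w).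
  under eq_fun do rewrite innerE.
  apply: cmeasurable_sum => i; apply: cmeasurableM; first exact: cmeasurable_cst.
  exact: cmeasurable_coord.
apply: cmeasurableM; first exact: mu.
have -> : inner v = (fun x => (inner x v)^*%C).
  by apply/funext => x; rewrite inner_conj.
by apply: cmeasurable_conj; exact: mu.
Qed.

Context {d0} {T0 : measurableType d0} (P0 : probability T0 R).
Context (X : T0 -> borel_cV R n).
Hypothesis mX : measurable_fun [set: T0] X.
Hypothesis isotropy :
  mx_expectation P0 (fun w => (X w : 'cV[R[i]]_n) *m (X w) ^t*) = 1%:M.

Let Q i j w : R[i] := (X w : 'cV[R[i]]_n) i ord0 * ((X w : 'cV[R[i]]_n) j ord0)^*%C.

Let cexpectationQ i j : cexpectation P0 (Q i j) = (i == j)%:R.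
Proof.
have := congr1 (fun A : 'M[R[i]]_n => A i j) isotropy; rewrite !mxE => <-.
by congr cexpectation; apply/funext => w; rewrite !mxE big_ord1 !mxE.
Qed.

Let cmeasurableX i : cmeasurable (fun w => (X w : 'cV[R[i]]_n) i ord0).
Proof.
have [mR mI] := cmeasurable_coord i.
by split; [apply: (measurableT_comp mR)|apply: (measurableT_comp mI)].
Qed.

(* The diagonal of the isotropy relation is nonzero, so its expectations are
   not the junk value that [fine] gives to an infinite integral. *)
Let integrable_sqr i : P0.-integrable [set: T0]
  (EFin \o (fun w => cmod ((X w : 'cV[R[i]]_n) i ord0) ^+ 2)).
Proof.
have [mR mI] := cmeasurableX i.
have e w : cmod ((X w : 'cV[R[i]]_n) i ord0) ^+ 2 = complex.Re (Q i i w).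
  by rewrite cmod_sqr /Q; case: ((X w : 'cV[R[i]]_n) i ord0) => a b /=; ring.
apply/integrableP; split.
  apply/measurable_EFinP; under eq_fun do rewrite cmod_sqr.
  by apply: measurable_funD; exact: measurable_funX.
under eq_integral => w _ do rewrite /= ger0_norm ?sqr_ge0//.
rewrite ltey; apply/eqP => h.
have := congr1 (@complex.Re R) (cexpectationQ i i).
rewrite cexpectationE eqxx/= /Rintegral.
under eq_integral do rewrite -e.
by rewrite h/= => /eqP; rewrite eq_sym oner_eq0.
Qed.

(** By the inequality between arithmetic and geometric means, both parts of [Q i j] are dominated by
    the sum of the squared moduli of coordinates [i] and [j], which is integrable by the diagonal
    case. *)
Let cintegrableQ i j : cintegrable P0 (Q i j).
Proof.
have [mR mI] : cmeasurable (Q i j).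
  by apply: cmeasurableM; [|apply: cmeasurable_conj]; exact: cmeasurableX.
have i12 := integrableD measurableT (integrable_sqr i) (integrable_sqr j).
have amgm (x y : R) : - (x ^+ 2 + y ^+ 2) <= 2 * (x * y) <= x ^+ 2 + y ^+ 2.
  by have := sqr_ge0 (x + y); have := sqr_ge0 (x - y); nra.
split; (apply: (le_integrable measurableT _ _ i12);
    [exact/measurable_EFinP|move=> w _ /=]);
  rewrite lee_fin [leRHS]ger0_norm ?addr_ge0 ?sqr_ge0// !cmod_sqr /Q;
  case: ((X w : 'cV[R[i]]_n) i ord0) => a b;
  case: ((X w : 'cV[R[i]]_n) j ord0) => a' b' /=;
  have /andP[? ?] := amgm a a'; have /andP[? ?] := amgm a b';
  have /andP[? ?] := amgm b a'; have /andP[? ?] := amgm b b';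
  have := sqr_ge0 a; have := sqr_ge0 b; have := sqr_ge0 a';
  have := sqr_ge0 b'; rewrite ler_norml; lra.
Qed.

(** Expanding both inner products gives a linear combination of the [Q i j]; isotropy leaves only
    the diagonal terms, whose coefficients sum to [inner v u]. *)
Lemma isotropic_form (u v : 'cV[R[i]]_n) :
  cintegrable P0 (fun w => inner (X w) u * inner v (X w)) /\
  cexpectation P0 (fun w => inner (X w) u * inner v (X w)) = inner v u.
Proof.
have -> : (fun w => inner (X w) u * inner v (X w)) = (fun w =>
    \sum_(ij : 'I_n * 'I_n)
      ((u ij.1 ord0)^*%C * v ij.2 ord0) * Q ij.1 ij.2 w).
  apply/funext => w; rewrite !innerE mulr_suml.
  rewrite -(pair_big predT predT (fun i j =>
     ((u i ord0)^*%C * v j ord0) * Q i j w))/=.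
  apply: eq_bigr => i _; rewrite mulr_sumr; apply: eq_bigr => j _.
  by rewrite /Q; ring.
have [iF eF] := cexpectation_lincomb P0 _ (index_enum ('I_n * 'I_n)%type)
  (fun ij => (u ij.1 ord0)^*%C * v ij.2 ord0) (fun ij => Q ij.1 ij.2)
  (fun ij => cintegrableQ ij.1 ij.2).
split=> //; rewrite eF innerE.
rewrite -(pair_big predT predT (fun i j =>
   ((u i ord0)^*%C * v j ord0) * cexpectation P0 (Q i j)))/=.
apply: eq_bigr => i _; rewrite (bigD1 i)//= cexpectationQ eqxx mulr1.
rewrite big1 ?addr0// => j ji.
by rewrite cexpectationQ eq_sym (negbTE ji) mulr0.
Qed.

(** Bernstein's inequality for the real part of one summand of the certificate, whose mean is
    [complex.Re (inner v u)]. *)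
Lemma isotropic_tail {d} {T : measurableType d} (P : probability T R)
    {I : finType} (Xs : I -> T -> borel_cV R n) (u v : 'cV[R[i]]_n) (M t : R) :
  iid_copies P P0 X Xs -> inner v v = 1 ->
  {ae P0, forall w, cmod (inner (X w) u) <= M} ->
  {ae P0, forall w, cmod (inner (X w) v) <= M} ->
  0 < t <= 2 ->
  1 <= M ^+ 2 /\
  (P [set w | (#|I|%:R * (complex.Re (inner v u) + t) <=
      \sum_l complex.Re (inner (Xs l w) u * inner v (Xs l w)))%R] <=
    (expR (- (#|I|%:R * (t ^+ 2 / (8 * M ^+ 2)))))%:E)%E.
Proof.
move=> iidX + bu bv /andP[t0 t2]; have t4 : t / 4 <= 1 / 2 by lra.
move=> v1.
have normM w : cmod (inner (X w) u * inner v (X w)) =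
    cmod (inner (X w) u) * cmod (inner (X w) v).
  by rewrite ComplexField.Normc.normcM -(inner_conj (X w)) cmod_conj.
have sqrv w : cmod (inner (X w) v) ^+ 2 =
    complex.Re (inner (X w) v * inner v (X w)).
  rewrite cmod_sqr -(inner_conj (X w)).
  by case: (inner (X w) v) => a b /=; ring.
have [[iv _] ev] := isotropic_form v v.
(* By isotropy this mean is [inner v v]. As the integrand is almost surely at most [M ^+ 2], the
   bound [M1] follows. *)
have Ev : (\int[P0]_w (cmod (inner (X w) v) ^+ 2)%:E = 1)%E.
  under eq_integral do rewrite sqrv.
  rewrite -[LHS]fineK ?integrable_fin_num//.
  have := congr1 (@complex.Re R) ev; rewrite v1 cexpectationE/= /Rintegral.
  by move=> ->.
have mv : measurable_fun [set: T0] (fun w => cmod (inner (X w) v) ^+ 2).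
  under eq_fun do rewrite sqrv.
  exact/measurable_EFinP/(measurable_int P0).
have M1 : 1 <= M ^+ 2.
  have : (\int[P0]_w (cmod (inner (X w) v) ^+ 2)%:E <= \int[P0]_w (M ^+ 2)%:E)%E.
    apply: ae_ge0_le_integral => //.
    - by move=> w _; rewrite lee_fin sqr_ge0.
    - exact/measurable_EFinP.
    - by move=> w _; rewrite lee_fin sqr_ge0.
    - apply: filterS bv => w bw _; rewrite lee_fin ler_pXn2r// nnegrE ?cmod_ge0//.
      exact: le_trans (cmod_ge0 _) bw.
  by rewrite Ev integral_cst_probability lee_fin.
split=> //.
have [[iu _] eu] := isotropic_form u v.
pose g (x : borel_cV R n) := complex.Re (inner x u * inner v x).
have mg : measurable_fun [set: borel_cV R n] g.
  by case: (cmeasurable_inner u v).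
have M0 : 0 < M ^+ 2 by exact: lt_le_trans ltr01 M1.
have Mn0 : M != 0 by move: M0; rewrite exprn_even_gt0.
have gmu : (\int[P0]_w (g (X w))%:E = (complex.Re (inner v u))%:E)%E.
  rewrite -[LHS]fineK ?integrable_fin_num//.
  have := congr1 (@complex.Re R) eu; rewrite cexpectationE/= /Rintegral.
  by move=> ->.
have gb : {ae P0, forall w, `|g (X w)| <= M * cmod (inner (X w) v)}.
  apply: filterS bu => w bw; apply: (le_trans (normr_Re_le_cmod _)).
  by rewrite normM ler_wpM2r// cmod_ge0.
(* Only the factor with [u] is bounded pointwise by [M]; the factor with [v] has mean square [1].
   This gives [M ^+ 2] instead of [M ^+ 4]. *)
have gv : (\int[P0]_w (g (X w) ^+ 2)%:E <= (M ^+ 2)%:E)%E.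
  rewrite -[leRHS]mule1 -Ev -ge0_integralZl//; last 3 first.
  - exact/measurable_EFinP.
  - by move=> w _; rewrite lee_fin sqr_ge0.
  - by rewrite lee_fin ltW.
  apply: ae_ge0_le_integral => //.
  - by move=> w _; rewrite lee_fin sqr_ge0.
  - apply/measurable_EFinP; apply: measurable_funX.
    exact: (measurableT_comp mg).
  - by move=> w _; rewrite -EFinM lee_fin mulr_ge0// ?sqr_ge0// ltW.
  - apply/measurable_EFinP; exact: measurable_funM.
  - apply: filterS gb => w bw _; rewrite -EFinM lee_fin -exprMn.
    rewrite -(real_normK (num_real (g (X w)))) ler_pXn2r// nnegrE//.
    exact: le_trans (normr_ge0 _) bw.
have gM : {ae P0, forall w, `|g (X w)| <= M ^+ 2}.
  apply: filterS2 gb bv => w gw bw; apply: (le_trans gw).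
  by rewrite expr2 ler_wpM2l// (le_trans _ bw)// cmod_ge0.
(* This value of [lam] maximises [lam * t - 2 * lam ^+ 2 * M ^+ 2], with maximum
   [t ^+ 2 / (8 * M ^+ 2)]; it is admissible because [t <= 2]. *)
have lam0 : 0 < t / (4 * M ^+ 2) by rewrite divr_gt0// mulr_gt0.
have lamM : t / (4 * M ^+ 2) * M ^+ 2 <= 1 / 2.
  have -> : t / (4 * M ^+ 2) * M ^+ 2 = t / 4 by field.
  exact: t4.
apply: (le_trans
  (bernstein P P0 X Xs g _ _ _ _ t mX iidX mg iu gmu gv gM lam0 lamM)).
rewrite lee_fin ler_expR lerN2 ler_wpM2l//.
rewrite le_eqVlt; apply/orP; left; apply/eqP; field => //.
Qed.

End isotropic_vector.

(** * From a dual certificate to the support *)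

Lemma cmod_sum_mul_le {R : rcfType} (I : Type) (s : seq I) (Q : pred I)
    (c al : I -> R[i]) (e : R) :
  (forall j, Q j -> cmod (al j) <= e) ->
  cmod (\sum_(j <- s | Q j) c j * al j) <= e * \sum_(j <- s | Q j) cmod (c j).
Proof.
move=> h; apply: (le_trans (cmod_sum _ _ _ _)); rewrite mulr_sumr.
apply: ler_sum => j Qj; rewrite ComplexField.Normc.normcM mulrC.
by apply: ler_wpM2r; [exact: cmod_ge0|exact: h].
Qed.

(* [al] and [be] are the values of a linear form, constant on the feasible set,
   on the two bases. *)
Lemma support_of_certificate {R : rcfType} (I : finType) (i0 : I)
    (al be c1 c2 d1 d2 : I -> R[i]) (e e' : R) :
  (forall j, j != i0 -> cmod (al j) <= e) -> (forall j, cmod (be j) <= e) ->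
  cmod (al i0 - 1) <= e' ->
  \sum_j d1 j * al j + \sum_j d2 j * be j =
    \sum_j c1 j * al j + \sum_j c2 j * be j ->
  \sum_j cmod (c1 j) + \sum_j cmod (c2 j) = 1 ->
  \sum_j cmod (d1 j) + \sum_j cmod (d2 j) <= 1 ->
  e * (2 - cmod (c1 i0)) < (1 - e') * cmod (c1 i0) -> d1 i0 != 0.
Proof.
move=> al_le be_le al1 eqL c_norm d_norm he; apply/eqP => d0.
have e0 : 0 <= e := le_trans (cmod_ge0 _) (be_le i0).
(* Since [d1 i0] vanishes, the equality of the two values of the form isolates the [i0] term of
   [c1]. *)
have eqc : c1 i0 * al i0 = \sum_(j | j != i0) d1 j * al j
    + \sum_j d2 j * be j
    - \sum_(j | j != i0) c1 j * al j - \sum_j c2 j * be j.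
  move: eqL; rewrite (bigD1 i0)//= d0 mul0r add0r => ->.
  by rewrite (bigD1 i0)//=; ring.
have hd1 := cmod_sum_mul_le _ (index_enum I) (fun j => j != i0) d1 al e al_le.
have hc1 := cmod_sum_mul_le _ (index_enum I) (fun j => j != i0) c1 al e al_le.
have hd2 := cmod_sum_mul_le _ (index_enum I) predT d2 be e (fun j _ => be_le j).
have hc2 := cmod_sum_mul_le _ (index_enum I) predT c2 be e (fun j _ => be_le j).
(* Apart from [c1 i0], the coefficients of [c1] and [c2] have total modulus [1 - cmod (c1 i0)];
   those of [d1] and [d2] contribute at most [1]. *)
have upper : cmod (c1 i0 * al i0) <= e * (2 - cmod (c1 i0)).
  rewrite eqc; apply: (le_trans (le_normcD _ _)); rewrite normcN.
  apply: (le_trans (lerD (le_normcD _ _) hc2)); rewrite normcN.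
  apply: (le_trans (lerD (lerD (le_normcD _ _) hc1) (lexx _))).
  apply: (le_trans (lerD (lerD (lerD hd1 hd2) (lexx _)) (lexx _))).
  rewrite -!mulrDr; apply: ler_wpM2l => //.
  move: c_norm d_norm; rewrite (bigD1 i0)//= [in X in _ -> X -> _](bigD1 i0)//=.
  by have := cmod_ge0 (d1 i0); lra.
have lower : (1 - e') * cmod (c1 i0) <= cmod (c1 i0 * al i0).
  rewrite ComplexField.Normc.normcM mulrC; apply: ler_wpM2l.
    exact: cmod_ge0.
  have := le_normcD (al i0) (1 - al i0).
  rewrite subrKC ComplexField.Normc.normc1 -(normcN (1 - al i0)) opprB.
  by lra.
by have := lt_le_trans he lower; rewrite ltNge upper.
Qed.

(** * Measurements and coherence *)

Section measurements.
Context {R : rcfType} {n : nat}.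

Lemma measurement_matrixE (m : nat) (X : 'I_m -> 'cV[R[i]]_n) (y : 'cV[R[i]]_n)
    (l : 'I_m) : (measurement_matrix X *m y) l ord0 = inner y (X l).
Proof. by rewrite /inner !mxE; apply: eq_bigr => j _; rewrite mxE. Qed.

Lemma le_coherence (Psi Theta : 'M[R[i]]_n) (i j : 'I_n) :
  cmod (inner (col i Psi) (col j Theta)) <= coherence Psi Theta.
Proof.
have h := le_bigmax 0 (fun i => max_corr (col i Psi) Theta) i.
apply: le_trans h; rewrite /max_corr.
exact: (le_bigmax 0 (fun j => cmod (inner (col i Psi) (col j Theta))) j).
Qed.

(** Otherwise column [i0] of [Psi] would be orthogonal to the whole basis [Theta], hence zero,
    against its unit norm. *)
Lemma coherence_gt0 (Psi Theta : 'M[R[i]]_n) (i0 : 'I_n) :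
  Psi \is unitarymx -> Theta \is unitarymx -> 0 < coherence Psi Theta.
Proof.
move=> uPsi uTheta; rewrite ltNge; apply/negP => k0.
have h j : inner (col i0 Psi) (col j Theta) = 0.
  apply: ComplexField.Normc.eq0_normc; apply/eqP; rewrite eq_le cmod_ge0 andbT.
  exact: le_trans (le_coherence _ _ _ _) k0.
have col0 : col i0 Psi = 0.
  have -> : col i0 Psi = Theta *m (Theta ^t* *m col i0 Psi).
    by have /unitarymxP uT' := uTheta; rewrite mulmxA uT' mul1mx.
  rewrite (_ : Theta ^t* *m col i0 Psi = 0) ?mulmx0//.
  apply/matrixP => j k; rewrite [RHS]mxE -[RHS](h j) ord1 innerE mxE.
  by apply: eq_bigr => l _; rewrite !mxE.
have := inner_unitary Psi i0 i0 uPsi.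
rewrite col0 innerE big1 ?eqxx => [/eqP|j _]; last by rewrite !mxE mulr0.
by rewrite eq_sym oner_eq0.
Qed.

Lemma le_max_corr (x : 'cV[R[i]]_n) (Psi : 'M[R[i]]_n) (j : 'I_n) :
  cmod (inner x (col j Psi)) <= max_corr x Psi.
Proof. exact: (le_bigmax 0 (fun j => cmod (inner x (col j Psi))) j). Qed.

End measurements.

(** * The union bound *)

Lemma measure_bigsetU_le {d} {T : measurableType d} {R : realType}
    (P : probability T R) {K : Type} (s : seq K) (B : K -> set T) :
  (forall k, measurable (B k)) ->
  (P (\big[setU/set0]_(k <- s) B k) <= \sum_(k <- s) P (B k))%E.
Proof.
move=> mB; elim: s => [|k s ih]; first by rewrite !big_nil measure0.
rewrite !big_cons.
apply: (@le_trans _ _ (P (B k) + P (\big[setU/set0]_(j <- s) B j))%E).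
  by apply: measureU2 => //; exact: bigsetU_measurable.
exact: leeD.
Qed.

(** The complement of the union of the bad events [B k] serves as the measurable subevent that
    [with_probability_gt] asks for. *)
Lemma with_probability_gt_union {d} {T : measurableType d} {R : realType}
    (P : probability T R) {K : finType} (B : K -> set T) (A : set T) (q del : R) :
  (forall k, measurable (B k)) -> (forall k, P (B k) <= q%:E)%E ->
  #|K|%:R * q < del -> (forall w, (forall k, ~ B k w) -> A w) ->
  with_probability_gt P (1 - del) A.
Proof.
move=> mB Bq qdel hA; pose N := \big[setU/set0]_k B k.
have mN : measurable N by exact: bigsetU_measurable.
exists (~` N); split.
- exact: measurableC.
- move=> w Nw; apply: hA => k Bk; apply: Nw.
  by rewrite /N (bigD1 k)//=; left.
- have PN : (P N <= (#|K|%:R * q)%:E)%E.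
    apply: (le_trans (measure_bigsetU_le _ _ _ mB)).
    apply: (@le_trans _ _ (\sum_(k : K) q%:E)%E); first exact: lee_sum.
    by rewrite sumEFin sumr_const mulr_natl.
  rewrite probability_setC//.
  have PNE : P N = (fine (P N))%:E by rewrite fineK ?fin_num_measure.
  by move: PN; rewrite PNE -EFinB lte_fin lee_fin => PN; lra.
Qed.

(** * Numerical estimates for the sample size *)

Section numeric_bounds.
Context {R : realType}.

(** The quadratic bound gives [expR (1 / 2) <= 2], so [expR 1 <= 4]. The lemma serves to force the
    integer [r] to be at least [2]. *)
Lemma ln8_gt1 (g : R) : 0 < g < 1 -> 1 < ln (8 / g).
Proof.
move=> /andP[g0 g1].
have e4 : expR 1 <= 4 :> R.
  have h := expR_le_quad (1 / 2 : R) (lexx _).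
  have -> : (1 : R) = 2%:R * (1 / 2) by field.
  rewrite expRM_natl; have := expR_gt0 (1 / 2 : R); nra.
have g8 : 8 < 8 / g by rewrite ltr_pdivlMr//; lra.
rewrite -ltr_expR lnK ?posrE; last by lra.
by lra.
Qed.

(** The exponent is [m] times [kappa ^+ 2 / (128 * M ^+ 2)], so the constant [512] bounds the
    exponential by the inverse of [x ^+ 4]. It remains that [delta * x ^+ 4 = n * r * x ^+ 3]
    exceeds [8 * n], which holds since [r] and [x] are at least [2]. *)
Lemma failure_lt (n r m : nat) (M kappa delta : R) :
  (0 < n)%N -> (1 < r)%N -> 0 < delta < 1 -> 0 < kappa -> 1 <= M ^+ 2 ->
  512 * (M ^+ 2 / kappa ^+ 2) * ln (n%:R * r%:R / delta) <= m%:R ->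
  (n * 8)%:R * expR (- (m%:R * ((kappa / 4) ^+ 2 / (8 * M ^+ 2)))) < delta.
Proof.
move=> n0 r1 /andP[d0 d1] k0 M1 hm; set x := n%:R * r%:R / delta in hm.
have n1 : 1 <= n%:R :> R by rewrite ler1n.
have r2 : 2 <= r%:R :> R by rewrite ler_nat.
have dx : delta * x = n%:R * r%:R by rewrite /x; field; rewrite gt_eqF.
have x2 : 2 <= x by rewrite /x ler_pdivlMr//; nra.
have M0 : 0 < M ^+ 2 by lra.
have Mn0 : M != 0 by move: M0; rewrite exprn_even_gt0.
have c0 : 0 < (kappa / 4) ^+ 2 / (8 * M ^+ 2).
  by apply: divr_gt0; [rewrite exprn_gt0// divr_gt0|rewrite mulr_gt0].
have hc : 4%:R * ln x <= m%:R * ((kappa / 4) ^+ 2 / (8 * M ^+ 2)).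
  apply: le_trans (ler_wpM2r (ltW c0) hm).
  rewrite le_eqVlt; apply/orP; left; apply/eqP; field.
  by rewrite Mn0 gt_eqF.
have x0 : 0 < x by lra.
have he : expR (- (m%:R * ((kappa / 4) ^+ 2 / (8 * M ^+ 2)))) <= (x ^+ 4)^-1.
  rewrite -[x in x ^+ 4]lnK ?posrE// -expRM_natl -expRN.
  by rewrite ler_expR lerN2.
apply: (@le_lt_trans _ _ ((n * 8)%:R * (x ^+ 4)^-1)).
  by apply: ler_wpM2l.
rewrite ltr_pdivrMr ?exprn_gt0// exprS mulrA dx natrM.
have x8 : 8 <= x ^+ 3.
  rewrite (_ : 8 = 2 ^+ 3 :> R); last by rewrite -natrX.
  by apply: lerXn2r; rewrite ?nnegrE; lra.
rewrite -mulrA ltr_pM2l ?(lt_le_trans _ n1)//.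
have : 2 * 8 <= r%:R * x ^+ 3 by apply: ler_pM.
by apply: lt_le_trans; lra.
Qed.

Lemma sample_size_le (Cg M kappa L : R) : 1 <= Cg -> 0 < kappa -> 0 <= L ->
  512 * (M ^+ 2 / kappa ^+ 2) * L <=
  512 * (Cg ^+ 2 * (M ^+ 2 / kappa ^+ 2) + Cg * (M ^+ 2 + kappa) / kappa) * L.
Proof.
move=> C1 k0 L0; apply: ler_wpM2r => //.
apply: ler_wpM2l; first exact: ler0n.
have C2 : 1 <= Cg ^+ 2 by nra.
have h1 : 0 <= M ^+ 2 / kappa ^+ 2 by rewrite divr_ge0 ?sqr_ge0.
have h2 : 0 <= Cg * (M ^+ 2 + kappa) / kappa.
  by rewrite divr_ge0 ?mulr_ge0 ?addr_ge0 ?sqr_ge0; lra.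
nra.
Qed.

End numeric_bounds.

(* Rotating a test vector by the four units +-1, +-i turns a bound on a complex
   modulus into four one-sided bounds on real parts. *)
Definition quarter_turn {R : rcfType} (b : bool * bool) : R[i] :=
  (-1) ^+ b.1 * (if b.2 then 'i%C else 1).

Lemma cmod_quarter_turn {R : rcfType} b : cmod (quarter_turn b : R[i]) = 1.
Proof.
have ci : cmod ('i%C : R[i]) = 1 by rewrite /= expr0n add0r expr1n sqrtr1.
case: b => [[] b2]; rewrite /quarter_turn /= ?expr0 ?expr1 ?mulN1r ?mul1r ?normcN;
  by case: b2; rewrite // ComplexField.Normc.normc1.
Qed.

(** The four bounds confine the real and the imaginary part to absolute value at most [s] each;
    adding the two gives the factor [2]. *)
Lemma cmod_le_quarter_turns {R : rcfType} (D : R[i]) (s : R) :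
  (forall b, complex.Re ((quarter_turn b)^*%C * D) < s) -> cmod D <= 2 * s.
Proof.
move=> h; apply: (le_trans (cmod_le_ReIm D)).
have := h (false, false); have := h (true, false).
have := h (false, true); have := h (true, true).
rewrite !cReM /quarter_turn /= ?expr0 ?expr1 => h1 h2 h3 h4.
have ha : `|complex.Re D| <= s by rewrite ler_norml; apply/andP; split; lra.
have hb : `|complex.Im D| <= s by rewrite ler_norml; apply/andP; split; lra.
lra.
Qed.

(** The deterministic half of the argument: the samples enter only through the uniform deviation
    bound over the vectors of both bases. *)
Lemma support_recovery {R : rcfType} {n m : nat} (Psi Theta : 'M[R[i]]_n)
    (X : 'I_m -> 'cV[R[i]]_n) (c1 c2 : 'cV[R[i]]_n) (i0 : 'I_n) :
  let kappa := coherence Psi Theta in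
  let x0 := Psi *m c1 + Theta *m c2 in
  let A := measurement_matrix X in
  Psi \is unitarymx -> norm1 c1 + norm1 c2 = 1 -> (0 < m)%N -> 0 < kappa ->
  4 * kappa < cmod (c1 i0 ord0) ->
  (forall (b : bool) (j : 'I_n), let phi := col j (if b then Psi else Theta) in
    cmod (\sum_l inner (X l) phi * inner (col i0 Psi) (X l)
          - m%:R * inner (col i0 Psi) phi) <= m%:R * (kappa / 2)) ->
  forall c1' c2', is_solution A Psi Theta (A *m x0) c1' c2' ->
  i0 \in supp c1'.
Proof.
move=> kappa x0 A uPsi c_norm m0 k0 hk dev c1' c2' [feas opt].
have {}opt := opt c1 c2 erefl.
have mR0 : 0 < m%:R :> R by rewrite ltr0n.
have mC0 : m%:R != 0 :> R[i] by rewrite pnatr_eq0 -lt0n.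
(* [Lam y] is [inner y v] for the certificate [v]; it depends on [y] only through the measurements
   [A *m y], whence [Lam_eq]. *)
pose Lam (y : 'cV[R[i]]_n) : R[i] :=
  m%:R^-1 * \sum_l inner y (X l) * inner (X l) (col i0 Psi).
have Lam_dev (b : bool) (j : 'I_n) :
    let phi := col j (if b then Psi else Theta) in
    cmod (Lam phi - inner phi (col i0 Psi)) <= kappa / 2.
  move=> phi.
  pose D := \sum_l inner (X l) phi * inner (col i0 Psi) (X l)
    - m%:R * inner (col i0 Psi) phi.
  have hD : cmod D <= m%:R * (kappa / 2) := dev b j.
  (* In [D] the arguments of the inner products are swapped, which conjugates the deviation and
     preserves its modulus. *)
  have -> : Lam phi - inner phi (col i0 Psi) = m%:R^-1 * D^*%C.
    rewrite /D rmorphB rmorphM rmorph_nat rmorph_sum /= inner_conj mulrBr mulKf//.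
    congr (_ * _ - _); apply: eq_bigr => l _.
    by rewrite rmorphM /= !inner_conj.
  rewrite ComplexField.Normc.normcM cmod_conj.
  have -> : cmod (m%:R^-1 : R[i]) = m%:R^-1.
    have := ComplexField.Normc.normcM (m%:R : R[i]) m%:R^-1.
    rewrite divff// ComplexField.Normc.normc1.
    have -> : cmod (m%:R : R[i]) = m%:R.
      by rewrite normcMn ComplexField.Normc.normc1.
    by move=> h; apply: (mulfI (lt0r_neq0 mR0)); rewrite -h divff ?lt0r_neq0.
  by rewrite mulrC ler_pdivrMr// mulrC.
have Lam_lin (e1 e2 : 'cV[R[i]]_n) : Lam (Psi *m e1 + Theta *m e2) =
    \sum_j e1 j ord0 * Lam (col j Psi) + \sum_j e2 j ord0 * Lam (col j Theta).
  have Lam_mul (Phi : 'M[R[i]]_n) (e : 'cV[R[i]]_n) :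
      Lam (Phi *m e) = \sum_j e j ord0 * Lam (col j Phi).
    rewrite /Lam; under eq_bigr do rewrite inner_mulmxl mulr_suml.
    rewrite exchange_big mulr_sumr; apply: eq_bigr => j _.
    rewrite [RHS]mulrCA [in RHS]mulr_sumr; congr (_ * _); apply: eq_bigr => l _.
    by rewrite mulrA.
  rewrite -!Lam_mul /Lam -mulrDr -big_split; congr (_ * _).
  by apply: eq_bigr => l _; rewrite innerDl mulrDl.
have Lam_eq : Lam (Psi *m c1' + Theta *m c2') = Lam x0.
  congr (_ * _); apply: eq_bigr => l _; congr (_ * _).
  by rewrite -!measurement_matrixE -/A feas.
have near (z w : R[i]) : cmod z <= cmod (z - w) + cmod w.
  by rewrite -{1}(subrK w z) le_normcD.
rewrite inE.
(* The inner product with column [i0] of [Psi] is [0] for the other columns of [Psi] and at most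
   [kappa] in modulus on [Theta]; the deviation adds [kappa / 2], hence [3 / 2 * kappa]. *)
apply: (support_of_certificate _ i0 (fun j => Lam (col j Psi))
  (fun j => Lam (col j Theta)) (fun j => c1 j ord0) (fun j => c2 j ord0)
  (fun j => c1' j ord0) (fun j => c2' j ord0) (3 / 2 * kappa) (kappa / 2)) => //.
- move=> j ji; have := Lam_dev true j => /=.
  rewrite inner_unitary// eq_sym (negbTE ji) subr0 => h.
  by apply: (le_trans h); lra.
- move=> j; have := Lam_dev false j => /= h.
  apply: (le_trans (near _ (inner (col j Theta) (col i0 Psi)))).
  rewrite -inner_conj cmod_conj in h *.
  have := le_coherence Psi Theta i0 j; rewrite -/kappa; lra.
- by have := Lam_dev true i0; rewrite /= inner_unitary// eqxx.
- by rewrite -!Lam_lin.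
- by rewrite -c_norm.
(* With [a] the modulus of the coefficient of [c1] at [i0], the goal amounts to
   [3 * kappa < a + kappa * a]. *)
- have c1_le : cmod (c1 i0 ord0) <= 1.
    rewrite -c_norm /norm1 (bigD1 i0)//= -addrA lerDl.
    by apply: addr_ge0; apply: sumr_ge0 => j _; exact: cmod_ge0.
  nra.
Qed.

(** * Choice of constants and union bound over both bases *)

Theorem proposition4p1 (R : realType) :
  exists K : R, 0 < K /\
  forall (n : nat) (Psi Theta : 'M[R[i]]_n)
    (hPsi : Psi \is unitarymx) (hTheta : Theta \is unitarymx)
    (d0 : measure_display) (T0 : measurableType d0) (P0 : probability T0 R)
    (X : T0 -> borel_cV R n) (hX : measurable_fun [set: T0] X) (M : R)
    (isotropy : mx_expectation P0 (fun w => (X w : 'cV[R[i]]_n) *m (X w) ^t*)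
                = 1%:M)
    (incoherence_Psi : {ae P0, forall w, max_corr (X w) Psi <= M})
    (incoherence_Theta : {ae P0, forall w, max_corr (X w) Theta <= M})
    (c1 c2 : 'cV[R[i]]_n) (hc : norm1 c1 + norm1 c2 = 1)
    (i0 : 'I_n) (hi0 : i0 \in supp c1)
    (gamma : R) (hgamma : 0 < gamma)
    (hkappa : coherence Psi Theta * (4 / cmod (c1 i0 ord0)) <= 1 - gamma)
    (delta : R) (hdelta : 0 < delta < 1)
    (m p r : nat) (hp : (0 < p)%N) (hr : (0 < r)%N) (hm : m = (p * r)%N)
    (d : measure_display) (T : measurableType d) (P : probability T R)
    (Xs : 'I_m -> T -> borel_cV R n) (hXs : iid_copies P P0 X Xs),
    let kappa := coherence Psi Theta in
    let Cgamma := 3 / gamma * (1 - 2 * gamma / 3) in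
    let x0 := Psi *m c1 + Theta *m c2 in
    let A := fun w => measurement_matrix (fun l => Xs l w) in
    ln (8 / gamma) <= r%:R ->
    K * (Cgamma ^+ 2 * (M ^+ 2 / kappa ^+ 2)
         + Cgamma * (M ^+ 2 + kappa) / kappa)
      * ln (n%:R * r%:R / delta) <= p%:R ->
    with_probability_gt P (1 - delta)
      [set w | forall c1' c2' : 'cV[R[i]]_n,
         is_solution (A w) Psi Theta (A w *m x0) c1' c2' ->
         i0 \in supp c1'].
Proof.
exists 512; split; first by rewrite ltr0n.
move=> n Psi Theta uPsi uTheta d0 T0 P0 X mX M iso incPsi incTheta c1 c2 c_norm
  i0 hi0 g g0 hk del hdel m p r p0 r0 -> d T P Xs iidX kappa Cg x0 A hr hp.
have a0 : 0 < cmod (c1 i0 ord0) by apply: cmod_gt0; move: hi0; rewrite inE.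
have k0 : 0 < kappa by exact: coherence_gt0.
have hk' : kappa * 4 <= (1 - g) * cmod (c1 i0 ord0).
  by rewrite -ler_pdivrMr// -mulrA.
(* The product in [hk'] is at least [kappa * 4], hence positive. *)
have g1 : g < 1 by rewrite -subr_gt0 -(pmulr_lgt0 _ a0); lra.
have ka : 4 * kappa < cmod (c1 i0 ord0) by nra.
have a1 : cmod (c1 i0 ord0) <= 1.
  rewrite -c_norm /norm1 (bigD1 i0)//= -addrA lerDl.
  by apply: addr_ge0; apply: sumr_ge0 => j _; exact: cmod_ge0.
have Cg1 : 1 <= Cg.
  have -> : Cg = 3 / g - 2 by rewrite /Cg; field; rewrite gt_eqF.
  by have : 3 <= 3 / g by [rewrite ler_pdivlMr//; lra]; lra.
have r1 : (1 < r)%N.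
  by rewrite -(ltr_nat R); apply: lt_le_trans hr; apply: ln8_gt1; rewrite g0.
have n0 : (0 < n)%N := leq_ltn_trans (leq0n _) (ltn_ord i0).
have L0 : 0 <= ln (n%:R * r%:R / del).
  have /andP[del0 del1] := hdel.
  apply: ln_ge0; rewrite ler_pdivlMr// mul1r (le_trans (ltW del1))// -natrM.
  by rewrite ler1n muln_gt0 n0.
have hm : 512 * (M ^+ 2 / kappa ^+ 2) * ln (n%:R * r%:R / del)
    <= (p * r)%:R.
  apply: (le_trans (sample_size_le Cg M kappa _ Cg1 k0 L0)).
  by apply: (le_trans hp); rewrite ler_nat leq_pmulr.
pose phi (k : bool * 'I_n) := col k.2 (if k.1 then Psi else Theta).
pose psi := col i0 Psi.
have psi1 : inner psi psi = 1 by rewrite inner_unitary// eqxx.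
have bphi k : {ae P0, forall w, cmod (inner (X w) (phi k)) <= M}.
  case: k => [[] j]; rewrite /phi /=.
    apply: filterS incPsi => w.
    exact: le_trans (le_max_corr _ _ _).
  apply: filterS incTheta => w.
  exact: le_trans (le_max_corr _ _ _).
have bu k b : {ae P0, forall w, cmod (inner (X w) (quarter_turn b *: phi k)) <= M}.
  apply: filterS (bphi k) => w; rewrite inner_scaler ComplexField.Normc.normcM.
  by rewrite cmod_conj cmod_quarter_turn mul1r.
have bpsi : {ae P0, forall w, cmod (inner (X w) psi) <= M} := bphi (true, i0).
(* The accuracy is [kappa / 4] because passing from four real parts to a modulus doubles it, and
   [support_recovery] allows [kappa / 2]. *)
have t02 : 0 < kappa / 4 <= 2.
  by rewrite divr_gt0//= ler_pdivrMr//; lra.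
have tail k b := isotropic_tail P0 X mX iso P Xs (quarter_turn b *: phi k) psi M
  (kappa / 4) iidX psi1 (bu k b) bpsi t02.
have [M1 _] := tail (true, i0) (true, true).
(* One bad event for each of the [2 * n] basis vectors and each of the four quarter turns, [8 * n]
   in all. *)
pose B (k : (bool * 'I_n) * (bool * bool)) := [set w |
  #|'I_(p * r)|%:R * (complex.Re (inner psi (quarter_turn k.2 *: phi k.1)) + kappa / 4)
  <= \sum_l complex.Re (inner (Xs l w) (quarter_turn k.2 *: phi k.1)
                       * inner psi (Xs l w))].
apply: (with_probability_gt_union P B _
  (expR (- ((p * r)%:R * ((kappa / 4) ^+ 2 / (8 * M ^+ 2)))))).
- move=> k.
  have [mXs _ _] := iidX.
  have mS : measurable_fun [set: T] (fun w =>
      \sum_l complex.Re (inner (Xs l w) (quarter_turn k.2 *: phi k.1)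
                       * inner psi (Xs l w))).
    apply: measurable_sum => l.
    have [mg _] := cmeasurable_inner (quarter_turn k.2 *: phi k.1) psi.
    exact: (measurableT_comp mg).
  have := mS measurableT _ (measurable_itv `[#|'I_(p * r)|%:R *
    (complex.Re (inner psi (quarter_turn k.2 *: phi k.1)) + kappa / 4), +oo[).
  rewrite setTI; congr measurable; apply/seteqP; split=> w /=;
    by rewrite in_itv/= andbT.
- move=> k; have [_ h] := tail k.1 k.2.
  by apply: (le_trans h); rewrite card_ord.
- rewrite !card_prod card_bool card_ord -mulnA mulnCA.
  have -> : (n * (2 * (2 * 2)) = n * 8)%N by [].
  exact: failure_lt hm.
move=> w good.
apply: support_recovery => //; first by rewrite muln_gt0 p0.
move=> b j; pose ph := phi (b, j).
pose D := \sum_l inner (Xs l w) ph * inner psi (Xs l w)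
  - (p * r)%:R * inner psi ph.
rewrite -[X in is_true X]/(cmod D <= (p * r)%:R * (kappa / 2)).
have -> : (p * r)%:R * (kappa / 2) = 2 * ((p * r)%:R * (kappa / 4)) by field.
apply: cmod_le_quarter_turns => q.
(* Outside the bad event the sum lies strictly below its threshold; the unit leaves the second
   argument of each inner product as its conjugate. *)
have /negP := good ((b, j), q); rewrite -ltNge /= card_ord -/ph.
rewrite inner_scaler mulrDr.
under eq_bigr do rewrite inner_scaler -mulrA.
rewrite /D mulrBr mulr_sumr (mulrCA _ (p * r)%:R (inner psi ph)).
rewrite cReB cRe_sum cRe_natmul.
by rewrite ltrBlDl.
Qed.
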